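(* Let $X$ be a compact metric space of negative type. Then the bilinear form $\langle\cdot,\cdot\rangle_{\mathscr{W}}$ is positive definite on the whole space $\mathscr{M}(X)$ of finite signed Borel measures on $X$: for every $\mu\in\mathscr{M}(X)$, $\langle\mu,\mu\rangle_{\mathscr{W}}\ge 0$, with equality only if $\mu=0$.
   Context: A metric space $(X,d)$ is of negative type if the metric space $(X,\sqrt{d})$ admits an isometric embedding into a (real) Hilbert space. The similarity kernel is $Z(x,y)=e^{-d(x,y)}$, and for finite signed Borel measures $\mu,\nu$ on $X$, $\langle \mu,\nu\rangle_{\mathscr{W}} = \int_X\int_X e^{-d(x,y)}\,\mu(dx)\,\nu(dy)$. *)

(* Defs.v *)
From HB Require Import structures.
From mathcomp Require Import all_boot all_order all_algebra.
From mathcomp Require Import all_classical all_reals all_analysis.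
Set Implicit Arguments.
Unset Strict Implicit.
Unset Printing Implicit Defensive.
Import Order.TTheory GRing.Theory Num.Theory.
Local Open Scope classical_set_scope.
Local Open Scope ring_scope.

Definition is_metric {R : realType} {T : Type} (dist : T -> T -> R) : Prop :=
  (forall x y, 0 <= dist x y) /\
  (forall x y, dist x y = 0 <-> x = y) /\
  (forall x y, dist x y = dist y x) /\
  (forall x y z, dist x z <= dist x y + dist y z).

Definition metric_open {R : realType} {T : Type} (dist : T -> T -> R)
  : set (set T) :=
  [set U | forall x, U x -> exists e : R, 0 < e /\ [set y | dist x y < e] `<=` U].

Definition metric_compact {R : realType} {T : Type} (dist : T -> T -> R) : Prop :=
  forall (I : Type) (U : I -> set T),
    (forall i, metric_open dist (U i)) ->
    (forall x, exists i, U i x) ->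
    exists (n : nat) (f : 'I_n -> I), forall x, exists k, U (f k) x.

Definition is_hilbert_inner_product {R : realType} {V : lmodType R}
  (ip : V -> V -> R) : Prop :=
  (forall u v, ip u v = ip v u) /\
  (forall a u v w, ip (a *: u + v) w = a * ip u w + ip v w) /\
  (forall v, v != 0 -> 0 < ip v v) /\
  (forall u : nat -> V,
     (forall e : R, 0 < e -> exists N, forall m n, (N <= m)%N -> (N <= n)%N ->
        Num.sqrt (ip (u m - u n) (u m - u n)) < e) ->
     exists v : V, forall e : R, 0 < e -> exists N, forall n, (N <= n)%N ->
        Num.sqrt (ip (u n - v) (u n - v)) < e).

Definition negative_type {R : realType} {T : Type} (dist : T -> T -> R) : Prop :=
  exists (V : lmodType R) (ip : V -> V -> R) (f : T -> V),
    is_hilbert_inner_product ip /\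
    forall x y, Num.sqrt (ip (f x - f y) (f x - f y)) = Num.sqrt (dist x y).

Definition simkernel {R : realType} {T : Type} (dist : T -> T -> R) (x y : T) : R :=
  expR (- dist x y).

(* Integral of a real function against the finite signed measure
   mu1 - mu2 (mu1, mu2 finite positive measures). *)
Definition signed_integral {d} {T : measurableType d} {R : realType}
  (mu1 mu2 : {finite_measure set T -> \bar R}) (f : T -> R) : R :=
  Rintegral mu1 setT f - Rintegral mu2 setT f.

Definition W_form {d} {T : measurableType d} {R : realType}
  (dist : T -> T -> R) (mu1 mu2 : {finite_measure set T -> \bar R}) : R :=
  signed_integral mu1 mu2 (fun y => signed_integral mu1 mu2 (fun x => simkernel dist x y)).

(* Main.v *)
(* Write d(x, y) = |f x - f y|^2 with f valued in a Hilbert space V, so that the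
   similarity kernel is the Gaussian kernel k(u, v) = exp(-|u - v|^2) restricted
   to f(X). By the Schur product theorem and the power series of exp, k is
   positive semidefinite on all of V. Discretizing sigma = mu1 - mu2 with fine
   partitions of unity, the quadratic form of k at sigma + t delta_v is
   nonnegative for every real t and every v in V, not only v in f(X):
     W(sigma, sigma) + 2 t h(v) + t^2 >= 0,  h(v) = int k(f x, v) dsigma(x).
   Hence W(sigma, sigma) >= 0, and W(sigma, sigma) = 0 forces h = 0 on V. In that
   case exp(-|f|^2) sigma integrates every exponential exp <f, w> to 0. The
   exponentials are stable under products, and bounded pointwise limits of their
   linear combinations give the indicators of finite intersections of the open
   half-spaces {<f, w> < c}. By compactness these generate the Borel sets. *)

Require Import Defs.
From HB Require Import structures.
From mathcomp Require Import all_boot all_order all_algebra.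
From mathcomp Require Import all_classical all_reals all_analysis.
From mathcomp Require Import measurable_realfun ring lra.
Import Order.TTheory GRing.Theory Num.Theory.
Import numFieldNormedType.Exports HBNNSimple.
Local Open Scope classical_set_scope.
Local Open Scope ring_scope.

Set Implicit Arguments.
Unset Strict Implicit.
Unset Printing Implicit Defensive.

(** * Positive semidefinite kernels and the Gaussian kernel *)

Definition psd {R : realType} {I : finType} (B : I -> I -> R) : Prop :=
  (forall i j, B i j = B j i) /\
  (forall c : I -> R, 0 <= \sum_i \sum_j c i * c j * B i j).

Lemma sum_delta (R : realType) (I : finType) (F : I -> R) (k : I) :
  \sum_i (i == k)%:R * F i = F k.
Proof.
rewrite (bigD1 k)//= eqxx mul1r big1 ?addr0// => i /negPf ->.
by rewrite mulr0n mul0r.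
Qed.

(** The cross terms merge by symmetry of [B]. Nonnegativity of this polynomial in [t] yields the
    diagonal, row and Schur complement facts below. *)
Lemma psd_quadratic (R : realType) (I : finType) (B : I -> I -> R) (c : I -> R)
    (k : I) (t : R) : psd B ->
  \sum_i \sum_j (c i + t * (i == k)%:R) * (c j + t * (j == k)%:R) * B i j =
  \sum_i \sum_j c i * c j * B i j + 2 * t * (\sum_i c i * B i k) + t ^+ 2 * B k k.
Proof.
move=> [sB _].
have -> : \sum_i \sum_j (c i + t * (i == k)%:R) * (c j + t * (j == k)%:R) * B i j =
    \sum_i (\sum_j c i * c j * B i j + t * (c i * B i k)
      + (i == k)%:R * (t * (\sum_j c j * B j i) + t ^+ 2 * B i k)).
  apply: eq_bigr => i _.
  transitivity (\sum_j (c i * c j * B i j + (t * c i) * ((j == k)%:R * B i j)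
     + ((i == k)%:R * t * (c j * B j i) + (i == k)%:R * t ^+ 2 * ((j == k)%:R * B i j)))).
    by apply: eq_bigr => j _; rewrite (sB j i); ring.
  rewrite !big_split/= -!mulr_sumr !sum_delta; ring.
rewrite !big_split/= sum_delta -mulr_sumr; ring.
Qed.

Lemma psd_diag_ge0 (R : realType) (I : finType) (B : I -> I -> R) (k : I) :
  psd B -> 0 <= B k k.
Proof.
move=> hB; have := psd_quadratic (fun=> 0) k 1 hB.
rewrite [X in _ = X + _ + _]big1 => [|i _]; last by rewrite big1// => j _; rewrite !mul0r.
rewrite [X in _ = _ + _ * X + _]big1 => [|i _]; last by rewrite mul0r.
rewrite mulr0 !add0r expr1n mul1r => <-; exact: hB.2.
Qed.

Lemma quadratic_ge0_linear0 (R : realType) (a b : R) :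
  (forall t, 0 <= a + t * b) -> b = 0.
Proof.
move=> h; apply/eqP; case: (ltgtP b 0) => // b0.
(* In both cases [t] is chosen so that [a + t * b] equals [-1]. *)
- have := h ((a + 1) / - b); rewrite invrN mulrN mulNr divfK ?lt_eqF//; lra.
- have := h (- (a + 1) / b); rewrite divfK ?gt_eqF//; lra.
Qed.

(* If [B k k = 0] then row [k] of [B] vanishes and the junk value [x / 0 = 0]
   makes the Schur complement [B] itself. *)
Lemma psd_schur_complement (R : realType) (I : finType) (B : I -> I -> R) (k : I) :
  psd B -> psd (fun i j => B i j - B i k * B j k / B k k).
Proof.
move=> hB; split=> [i j|c]; first by rewrite hB.1 (mulrC (B i k)).
(* This [t] minimises the polynomial of [psd_quadratic]; the minimum is the form of the Schur
   complement at [c]. *)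
have := hB.2 (fun i => c i + (- (\sum_i c i * B i k) / B k k) * (i == k)%:R).
rewrite psd_quadratic// => /le_trans; apply.
have -> : \sum_i \sum_j c i * c j * (B i j - B i k * B j k / B k k) =
  \sum_i \sum_j c i * c j * B i j - (\sum_i c i * B i k) ^+ 2 / B k k.
  rewrite expr2 mulr_suml mulr_suml -sumrB; apply: eq_bigr => i _.
  rewrite mulr_sumr mulr_suml -sumrB; apply: eq_bigr => j _; ring.
case: (eqVneq (B k k) 0) => [->|bk]; first by rewrite invr0 !mulr0 mul0r !addr0 subr0.
rewrite le_eqVlt; apply/orP; left; apply/eqP; field; exact: bk.
Qed.

(** At the [i]-th unit vector the polynomial of [psd_quadratic] loses its square term, and an affine
    function of [t] that stays nonnegative has slope 0. *)
Lemma psd_row0 (R : realType) (I : finType) (B : I -> I -> R) (k i : I) :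
  psd B -> B k k = 0 -> B i k = 0.
Proof.
move=> hB bk; suff : 2 * B i k = 0 by lra.
apply: (@quadratic_ge0_linear0 _ (B i i)) => t.
have := hB.2 (fun j => (j == i)%:R + t * (j == k)%:R).
rewrite psd_quadratic// bk mulr0 addr0.
under eq_bigr => j _ do under eq_bigr => l _ do rewrite -mulrA.
under eq_bigr => j _ do rewrite -mulr_sumr.
rewrite !sum_delta; lra.
Qed.

(* Peel rank-one kernels off [B] by Schur complements until it vanishes. *)
Lemma psd_hadamard (R : realType) (I : finType) (A B : I -> I -> R) :
  psd A -> psd B -> psd (fun i j => A i j * B i j).
Proof.
move=> hA hB; split=> [i j|c]; first by rewrite hA.1 hB.1.
(* Induction on the number of nonzero diagonal entries: a Schur complement clears entry [k] and
   keeps the zero ones. *)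
have [n] := ubnP #|[pred i | B i i != 0]|.
elim: n B hB => // n IH B hB; rewrite ltnS => hn.
have [/existsP[k bk]|/existsPn b0] := boolP [exists k, B k k != 0]; last first.
  rewrite big1// => i _; rewrite big1// => j _.
  by rewrite (@psd_row0 _ _ B j i) ?mulr0//; apply/eqP; have := b0 j; rewrite negbK.
pose B' i j := B i j - B i k * B j k / B k k.
have hB' : psd B' by exact: psd_schur_complement.
have bk0 : 0 < B k k by rewrite lt_neqAle eq_sym bk psd_diag_ge0.
(* The rank-one part contributes the form of [A] at the rescaled vector [c i * B i k]. *)
have -> : \sum_i \sum_j c i * c j * (A i j * B i j) =
  \sum_i \sum_j c i * c j * (A i j * B' i j) +
  (B k k)^-1 * \sum_i \sum_j (c i * B i k) * (c j * B j k) * A i j.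
  rewrite mulr_sumr -big_split; apply: eq_bigr => i _ /=.
  rewrite mulr_sumr -big_split; apply: eq_bigr => j _ /=.
  rewrite /B'; ring.
rewrite addr_ge0//; last by rewrite mulr_ge0 ?invr_ge0 ?(ltW bk0)//; exact: hA.2.
apply: IH => //; apply: leq_trans hn; apply: proper_card.
apply/properP; split; last first.
  exists k; rewrite !inE/= // /B' negbK mulfK ?subrr//.
apply/fintype.subsetP => i; rewrite !inE; apply: contraNN => /eqP bi.
by rewrite /B' bi (hB.1 i k) (psd_row0 k hB bi) !mul0r subrr.
Qed.

Lemma psd_exprn (R : realType) (I : finType) (B : I -> I -> R) n :
  psd B -> psd (fun i j => B i j ^+ n).
Proof.
move=> hB; elim: n => [|n IH].
  split=> // c; have -> : \sum_i \sum_j c i * c j * B i j ^+ 0 = (\sum_i c i) ^+ 2.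
    rewrite expr2 mulr_suml; apply: eq_bigr => i _.
    by rewrite mulr_sumr; apply: eq_bigr => j _; rewrite expr0 mulr1.
  exact: sqr_ge0.
have := psd_hadamard hB IH.
by congr (psd _); apply/funext => i; apply/funext => j; rewrite exprS.
Qed.

Lemma cvg_series_expR (R : realType) (x : R) :
  series (exp_coeff x) @ \oo --> expR x.
Proof. exact: is_cvg_series_exp_coeff. Qed.

(** The partial sums of the exponential series are nonnegative combinations of Hadamard powers, and
    nonnegativity passes to the limit. *)
Lemma psd_expR (R : realType) (I : finType) (B : I -> I -> R) :
  psd B -> psd (fun i j => expR (B i j)).
Proof.
move=> hB; split=> [i j|c]; first by rewrite hB.1.
have h : (fun n => \sum_i \sum_j c i * c j * series (exp_coeff (B i j)) n) @ \oo -->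
    \sum_i \sum_j c i * c j * expR (B i j).
  apply: cvg_big => [|i _]; first exact: add_continuous.
  apply: cvg_big => [|j _]; first exact: add_continuous.
  by apply: cvgMl_tmp; exact: cvg_series_expR.
rewrite -(cvg_lim _ h)//; apply: limr_ge; first by apply/cvg_ex; eexists; exact: h.
apply: nearW => n.
have -> : \sum_i \sum_j c i * c j * series (exp_coeff (B i j)) n =
  \sum_(0 <= m < n) m`!%:R^-1 * \sum_i \sum_j c i * c j * B i j ^+ m.
  under [RHS]eq_bigr do rewrite mulr_sumr.
  rewrite [RHS]exchange_big; apply: eq_bigr => i _ /=.
  under [RHS]eq_bigr do rewrite mulr_sumr.
  rewrite [RHS]exchange_big; apply: eq_bigr => j _ /=.
  rewrite /series/= mulr_sumr; apply: eq_bigr => m _.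
  by rewrite /exp_coeff/= mulrA mulrC.
apply: sumr_ge0 => m _; rewrite mulr_ge0 ?invr_ge0//.
exact: (psd_exprn m hB).2.
Qed.

(** * Inner product spaces and their Gaussian kernels *)

Section inner_product.
Context {R : realType} {V : lmodType R} (ip : V -> V -> R).
Hypothesis hip : is_hilbert_inner_product ip.

Lemma ipC u v : ip u v = ip v u. Proof. exact: hip.1. Qed.

Lemma ipDl u v w : ip (u + v) w = ip u w + ip v w.
Proof. by have := hip.2.1 1 u v w; rewrite scale1r mul1r. Qed.

Lemma ip0l w : ip 0 w = 0.
Proof. by have := ipDl 0 0 w; rewrite addr0 => h; lra. Qed.

Lemma ipZl a u w : ip (a *: u) w = a * ip u w.
Proof. by have := hip.2.1 a u 0 w; rewrite addr0 ip0l addr0. Qed.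

Lemma ipNl u w : ip (- u) w = - ip u w.
Proof. by rewrite -scaleN1r ipZl mulN1r. Qed.

Lemma ipBl u v w : ip (u - v) w = ip u w - ip v w.
Proof. by rewrite ipDl ipNl. Qed.

Lemma ip0r w : ip w 0 = 0. Proof. by rewrite ipC ip0l. Qed.

Lemma ipDr u v w : ip w (u + v) = ip w u + ip w v.
Proof. by rewrite ipC ipDl !(ipC w). Qed.

Lemma ipZr a u w : ip w (a *: u) = a * ip w u.
Proof. by rewrite ipC ipZl ipC. Qed.

Lemma ipNr u w : ip w (- u) = - ip w u.
Proof. by rewrite ipC ipNl ipC. Qed.

Lemma ipBr u v w : ip w (u - v) = ip w u - ip w v.
Proof. by rewrite ipDr ipNr. Qed.

Lemma ip_ge0 u : 0 <= ip u u.
Proof.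
by have [->|/hip.2.2.1/ltW//] := eqVneq u 0; rewrite ip0l.
Qed.

Lemma ip_suml (I : finType) (F : I -> V) w : ip (\sum_i F i) w = \sum_i ip (F i) w.
Proof.
by apply: (big_morph (fun v => ip v w)) => [u v|]; rewrite ?ipDl ?ip0l.
Qed.

Definition ipnorm (u : V) : R := Num.sqrt (ip u u).

Lemma ipnorm_ge0 u : 0 <= ipnorm u. Proof. exact: sqrtr_ge0. Qed.

Lemma ipnormK u : ipnorm u ^+ 2 = ip u u.
Proof. by rewrite sqr_sqrtr// ip_ge0. Qed.

Lemma cauchy_schwarz u v : `|ip u v| <= ipnorm u * ipnorm v.
Proof.
rewrite -[leRHS]ger0_norm ?mulr_ge0 ?ipnorm_ge0// -ler_sqr ?nnegrE ?normr_ge0//.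
rewrite !real_normK ?num_real// exprMn !ipnormK.
have [->|v0] := eqVneq v 0; first by rewrite ip0r ip0l mulr0 expr0n.
have vp := hip.2.2.1 _ v0.
(* This square norm is [ip v v] times the Gram determinant of [u] and [v]; the positive factor then
   cancels. *)
have := ip_ge0 (ip v v *: u - ip u v *: v).
rewrite ipBl !ipBr !ipZl !ipZr (ipC v u) => h.
have : 0 <= ip v v * (ip u u * ip v v - ip u v ^+ 2) by nra.
by rewrite pmulr_rge0// subr_ge0.
Qed.

Lemma ipnormD u v : ipnorm (u + v) <= ipnorm u + ipnorm v.
Proof.
rewrite -ler_sqr ?nnegrE ?addr_ge0 ?ipnorm_ge0//.
rewrite ipnormK sqrrD !ipnormK ipDl !ipDr (ipC v u).
have := cauchy_schwarz u v; have := ler_norm (ip u v); lra.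
Qed.

Lemma ipnormN u : ipnorm (- u) = ipnorm u.
Proof. by rewrite /ipnorm ipNl ipNr opprK. Qed.

Lemma ipnorm_dist u v : `|ipnorm u - ipnorm v| <= ipnorm (u - v).
Proof.
have := ipnormD (u - v) v; have := ipnormD (v - u) u; rewrite !subrK.
rewrite -(ipnormN (v - u)) opprB => h1 h2; rewrite ler_norml; apply/andP; split; lra.
Qed.

Lemma psd_ip (I : finType) (u : I -> V) : psd (fun i j => ip (u i) (u j)).
Proof.
split=> [i j|c]; first exact: ipC.
have -> : \sum_i \sum_j c i * c j * ip (u i) (u j) =
    ip (\sum_i c i *: u i) (\sum_i c i *: u i).
  rewrite ip_suml; apply: eq_bigr => i _.
  rewrite ipC ip_suml; apply: eq_bigr => j _.
  by rewrite ipZl ipZr (ipC (u j)); ring.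
exact: ip_ge0.
Qed.

Definition gauss (u v : V) : R := expR (- ip (u - v) (u - v)).

Lemma gaussE u v :
  gauss u v = expR (- ip u u) * expR (- ip v v) * expR (ip u (2 *: v)).
Proof.
rewrite /gauss -!expRD; congr expR.
by rewrite ipBl !ipBr ipZr (ipC v u); ring.
Qed.

Lemma gaussC u v : gauss u v = gauss v u.
Proof. by rewrite /gauss -opprB ipNl ipNr opprK. Qed.

Lemma gauss_refl u : gauss u u = 1.
Proof. by rewrite /gauss subrr ip0l oppr0 expR0. Qed.

(** By [gaussE] the kernel is [exp (2 <u, v>)] with rows and columns rescaled by positive weights,
    and the weights are absorbed into [c]. The factor 2 comes from scaling the vectors of a Gram
    kernel by the square root of 2. *)
Lemma psd_gauss (I : finType) (u : I -> V) : psd (fun i j => gauss (u i) (u j)).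
Proof.
split=> [i j|c]; first exact: gaussC.
have h : psd (fun i j => 2 * ip (u i) (u j)).
  have := psd_ip (fun i => Num.sqrt 2 *: u i); congr psd.
  apply/funext => i; apply/funext => j.
  by rewrite ipZl ipZr mulrA -expr2 sqr_sqrtr.
have := (psd_expR h).2 (fun i => c i * expR (- ip (u i) (u i))).
congr (0 <= _); apply: eq_bigr => i _; apply: eq_bigr => j _.
by rewrite gaussE ipZr; ring.
Qed.

End inner_product.

(** For [b - a < 1], factor out [E = exp (- a^2)] and use [1 - exp (-x) <= x] with
    [b^2 - a^2 = (b - a) (2 a + (b - a))]. The constant is 1 + 1: [2 a E <= 1], since
    [2 a <= 1 + a^2 <= exp (a^2)], and [(b - a) E <= 1]. *)
Lemma expR_sqr_lipschitz_aux (R : realType) (a b : R) : 0 <= a -> a <= b ->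
  expR (- a ^+ 2) - expR (- b ^+ 2) <= 2 * (b - a).
Proof.
move=> a0 ab.
have [ba|ba] := leP 1 (b - a).
  have := expR_ge0 (- b ^+ 2); have : expR (- a ^+ 2) <= 1.
    by rewrite expR_le1 oppr_le0 sqr_ge0.
  lra.
have -> : expR (- b ^+ 2) = expR (- a ^+ 2) * expR (a ^+ 2 - b ^+ 2).
  by rewrite -expRD; congr expR; ring.
have h1 : 1 + (a ^+ 2 - b ^+ 2) <= expR (a ^+ 2 - b ^+ 2) by exact: expR_ge1Dx.
have e0 := expR_gt0 (- a ^+ 2).
have h2 : 2 * a * expR (- a ^+ 2) <= 1.
  have /le_trans : 2 * a * expR (- a ^+ 2) <= expR (a ^+ 2) * expR (- a ^+ 2).
    rewrite ler_pM2r//; have := expR_ge1Dx (a ^+ 2); have := sqr_ge0 (a - 1); nra.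
  by apply; rewrite -expRD subrr expR0.
have h3 : expR (- a ^+ 2) <= 1 by rewrite expR_le1 oppr_le0 sqr_ge0.
move: (expR (- a ^+ 2)) (expR (a ^+ 2 - b ^+ 2)) e0 h1 h2 h3 => E F e0 h1 h2 h3.
have : E * (1 - F) <= E * (b ^+ 2 - a ^+ 2) by rewrite ler_pM2l//; lra.
have -> : E * (b ^+ 2 - a ^+ 2) = (b - a) * (2 * a * E + (b - a) * E) by ring.
have h4 : 2 * a * E + (b - a) * E <= 2 by nra.
have : (b - a) * (2 * a * E + (b - a) * E) <= (b - a) * 2 by rewrite ler_wpM2l//; lra.
lra.
Qed.

Lemma expR_sqr_lipschitz (R : realType) (a b : R) : 0 <= a -> 0 <= b ->
  `|expR (- a ^+ 2) - expR (- b ^+ 2)| <= 2 * `|a - b|.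
Proof.
wlog ab : a b / a <= b => [hw a0 b0|a0 b0].
  by have [/hw|/ltW/hw] := leP a b; [exact|rewrite distrC (distrC b); exact].
rewrite ger0_norm ?subr_ge0 ?ler_expR ?lerN2 ?ler_sqr//.
by rewrite ler0_norm ?subr_le0// opprB expR_sqr_lipschitz_aux.
Qed.

Lemma gauss_lipschitz (R : realType) (V : lmodType R) (ip : V -> V -> R)
    (hip : is_hilbert_inner_product ip) u u' v :
  `|gauss ip u v - gauss ip u' v| <= 2 * ipnorm ip (u - u').
Proof.
rewrite /gauss -!(ipnormK hip).
apply: le_trans (expR_sqr_lipschitz _ _) _; rewrite ?ipnorm_ge0//.
rewrite ler_pM2l//; apply: le_trans (ipnorm_dist hip _ _) _.
by rewrite opprB addrA subrK.
Qed.

(** * Integration against a difference of finite measures *)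

(** The integrands used throughout: an algebra of functions integrable against every finite
    measure. *)
Definition bmeas {d} {T : measurableType d} {R : realType} (g : T -> R) : Prop :=
  measurable_fun setT g /\ exists M, forall x, `|g x| <= M.

Section bounded_measurable.
Context {d} {T : measurableType d} {R : realType}.
Implicit Types (g h : T -> R) (mu : {finite_measure set T -> \bar R}).

Lemma bmeas_cst (c : R) : bmeas (fun _ : T => c).
Proof. by split; [exact: measurable_cst|exists `|c|]. Qed.

Lemma bmeasD g h : bmeas g -> bmeas h -> bmeas (fun x => g x + h x).
Proof.
move=> [mg [M gM]] [mh [N hN]]; split; first exact: measurable_funD.
by exists (M + N) => x; rewrite (le_trans (ler_normD _ _))// lerD.
Qed.

Lemma bmeasM g h : bmeas g -> bmeas h -> bmeas (fun x => g x * h x).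
Proof.
move=> [mg [M gM]] [mh [N hN]]; split; first exact: measurable_funM.
by exists (M * N) => x; rewrite normrM ler_pM.
Qed.

Lemma bmeasZ (c : R) g : bmeas g -> bmeas (fun x => c * g x).
Proof. by move=> ?; apply: bmeasM => //; exact: bmeas_cst. Qed.

Lemma bmeasB g h : bmeas g -> bmeas h -> bmeas (fun x => g x - h x).
Proof.
move=> bg bh; have := bmeasD bg (bmeasZ (-1) bh); congr bmeas.
by apply/funext => x; rewrite mulN1r.
Qed.

Lemma bmeas_sum (I : Type) (r : seq I) (P : pred I) (F : I -> T -> R) :
  (forall i, bmeas (F i)) -> bmeas (fun x => \sum_(i <- r | P i) F i x).
Proof.
move=> bF; elim: r => [|i r IH].
  by under eq_fun do rewrite big_nil; exact: bmeas_cst.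
under eq_fun do rewrite big_cons.
by case: (P i) => //; exact: bmeasD.
Qed.

Lemma bmeas_prod (I : Type) (r : seq I) (P : pred I) (F : I -> T -> R) :
  (forall i, bmeas (F i)) -> bmeas (fun x => \prod_(i <- r | P i) F i x).
Proof.
move=> bF; elim: r => [|i r IH].
  by under eq_fun do rewrite big_nil; exact: bmeas_cst.
under eq_fun do rewrite big_cons.
by case: (P i) => //; exact: bmeasM.
Qed.

Lemma bmeas_indic (A : set T) : measurable A -> bmeas (\1_A : T -> R).
Proof.
move=> mA; split; first exact: measurable_indic.
by exists 1 => x; rewrite indicE; case: (_ \in _); rewrite ?normr1 ?normr0.
Qed.

Lemma bmeas_integrable mu g : bmeas g -> mu.-integrable setT (EFin \o g).
Proof.
move=> [mg [M gM]]; apply: measurable_bounded_integrable => //.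
  exact: fin_num_fun_lty (fin_num_measure mu).
exists M; split; first exact: num_real.
by move=> N MN x _; exact: le_trans (gM x) (ltW MN).
Qed.

(** Dominated convergence; the constant [M] is integrable because [mu] is finite. *)
Lemma cvg_Rintegral mu (g_ : nat -> T -> R) g (M : R) :
  (forall n, measurable_fun setT (g_ n)) -> (forall n x, `|g_ n x| <= M) ->
  (forall x, g_ ^~ x @ \oo --> g x) ->
  (fun n => Rintegral mu setT (g_ n)) @ \oo --> Rintegral mu setT g.
Proof.
move=> mg gM gg.
have bg n : bmeas (g_ n) by split => //; exists M.
have mlim : measurable_fun setT g.
  by apply: measurable_fun_cvg => [n|x _]; [exact: mg|exact: gg].
have iM : mu.-integrable setT (EFin \o (fun=> M)).
  exact/bmeas_integrable/bmeas_cst.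
have [||||| ig _ h] := @dominated_convergence _ _ _ mu setT measurableT
  (fun n => EFin \o g_ n) (EFin \o g) (EFin \o (fun=> M)).
- by move=> n; exact/measurable_EFinP.
- exact/measurable_EFinP.
- by apply: aeW => x _; exact/cvg_EFin/gg/nearW.
- exact: iM.
- by apply: aeW => x n _; rewrite /= lee_fin.
apply: fine_cvg; rewrite fineK//; exact: integrable_fin_num.
Qed.

End bounded_measurable.

Section signed_integral_theory.
Context {d} {T : measurableType d} {R : realType}.
Variables mu1 mu2 : {finite_measure set T -> \bar R}.
Implicit Types g h : T -> R.
Local Notation I := (signed_integral mu1 mu2).

Lemma signed_integralD g h : bmeas g -> bmeas h ->
  I (fun x => g x + h x) = I g + I h.
Proof.
move=> bg bh; rewrite /signed_integral !RintegralD//;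
  try exact: bmeas_integrable.
ring.
Qed.

Lemma signed_integralZ c g : bmeas g -> I (fun x => c * g x) = c * I g.
Proof.
move=> bg; rewrite /signed_integral !RintegralZl//;
  try exact: bmeas_integrable.
ring.
Qed.

Lemma signed_integralB g h : bmeas g -> bmeas h ->
  I (fun x => g x - h x) = I g - I h.
Proof.
move=> bg bh.
have -> : (fun x => g x - h x) = (fun x => g x + -1 * h x).
  by apply/funext => x; rewrite mulN1r.
by rewrite signed_integralD// ?signed_integralZ ?mulN1r//; exact: bmeasZ.
Qed.

Lemma signed_integral0 : I (fun=> 0) = 0.
Proof. by rewrite /signed_integral !Rintegral_cst// !mul0r subrr. Qed.

Lemma signed_integral_sum (J : Type) (r : seq J) (F : J -> T -> R) :
  (forall i, bmeas (F i)) ->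
  I (fun x => \sum_(i <- r) F i x) = \sum_(i <- r) I (F i).
Proof.
move=> bF; elim: r => [|i r IH].
  by rewrite big_nil; under eq_fun do rewrite big_nil; exact: signed_integral0.
rewrite big_cons -IH -signed_integralD//; last exact: bmeas_sum.
by under eq_fun do rewrite big_cons.
Qed.

(** An upper bound for the total variation of [mu1 - mu2]; the two measures may overlap. *)
Definition total_mass : R := fine (mu1 setT) + fine (mu2 setT).

Lemma total_mass_ge0 : 0 <= total_mass.
Proof. by rewrite addr_ge0 ?fine_ge0. Qed.

Lemma signed_integral_bound g M : bmeas g -> (forall x, `|g x| <= M) ->
  `|I g| <= total_mass * M.
Proof.
move=> bg gM.
have h (mu : {finite_measure set T -> \bar R}) :
    `|Rintegral mu setT g| <= fine (mu setT) * M.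
  rewrite (le_trans (le_normr_Rintegral _ _))//; first exact: bmeas_integrable.
  rewrite mulrC -Rintegral_cst//; apply: le_Rintegral => //.
  - apply: bmeas_integrable; split; first exact: measurableT_comp bg.1.
    by exists M => x; rewrite normr_id.
  - exact/bmeas_integrable/bmeas_cst.
by rewrite (le_trans (ler_normB _ _))// mulrDl lerD.
Qed.

Lemma cvg_signed_integral (g_ : nat -> T -> R) g (M : R) :
  (forall n, measurable_fun setT (g_ n)) -> (forall n x, `|g_ n x| <= M) ->
  (forall x, g_ ^~ x @ \oo --> g x) ->
  (fun n => I (g_ n)) @ \oo --> I g.
Proof.
by move=> mg gM gg; apply: cvgB; exact: cvg_Rintegral gM gg.
Qed.

Lemma signed_integral_lim0 (g_ : nat -> T -> R) g (M : R) :
  (forall n, measurable_fun setT (g_ n)) -> (forall n x, `|g_ n x| <= M) ->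
  (forall x, g_ ^~ x @ \oo --> g x) -> (forall n, I (g_ n) = 0) -> I g = 0.
Proof.
move=> mg gM gg g0; have := cvg_signed_integral mg gM gg.
under eq_fun do rewrite g0.
by move=> /cvg_lim => <-//; rewrite lim_cst.
Qed.

Lemma signed_integral_indic (A : set T) : measurable A ->
  I (\1_A) = fine (mu1 A) - fine (mu2 A).
Proof.
move=> mA; rewrite /signed_integral /Rintegral/=.
by rewrite !integral_indic// !setIT.
Qed.

End signed_integral_theory.

(** * The quadratic form of the similarity kernel *)

Lemma ge0_of_small (R : realType) (a K : R) : 0 <= K ->
  (forall e, 0 < e -> 0 <= a + e * K) -> 0 <= a.
Proof.
move=> K0 h; rewrite leNgt; apply/negP => a0.
have K1 : 0 < 2 * (K + 1) by lra.
(* At this [e] the bound reads [a (K + 2) / (2 (K + 1))], which is negative if [a] is. *)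
have := h (- a / (2 * (K + 1))); rewrite divr_gt0 ?oppr_gt0// => /(_ isT).
rewrite (_ : a + _ = (a * (K + 2)) / (2 * (K + 1))); last by field; lra.
by rewrite pmulr_lge0 ?invr_gt0//; nra.
Qed.

(** For indicators [b k], the [k]-th term says that [k] is the first index hit, and the product on
    the right vanishes as soon as some index is hit. *)
Lemma sum_first_hit (R : comPzRingType) (b : nat -> R) n :
  \sum_(k < n) b k * \prod_(j < k) (1 - b j) = 1 - \prod_(j < n) (1 - b j).
Proof.
elim: n => [|n IH]; first by rewrite !big_ord0 subrr.
by rewrite !big_ord_recr/= IH mulrBr mulr1 (mulrC (b n)); ring.
Qed.

Lemma convex_comb_dist (R : realType) n (p b : 'I_n -> R) (a e : R) :
  (forall k, 0 <= p k) -> \sum_k p k = 1 ->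
  (forall k, p k != 0 -> `|a - b k| <= e) -> `|a - \sum_k p k * b k| <= e.
Proof.
move=> p0 p1 pe.
have -> : a - \sum_k p k * b k = \sum_k p k * (a - b k).
  rewrite -[X in X - _]mul1r -p1 mulr_suml -sumrB.
  by apply: eq_bigr => k _; rewrite mulrBr.
rewrite (le_trans (ler_norm_sum _ _ _))//.
rewrite -[leRHS]mul1r -p1 mulr_suml; apply: ler_sum => k _.
rewrite normrM (ger0_norm (p0 k)).
have [->|pk] := eqVneq (p k) 0; first by rewrite !mul0r.
by rewrite ler_wpM2l// pe.
Qed.

(** * Continuous functions and partitions of unity on a compact metric space *)

Section metric_space.
Context {R : realType} {d} {T : measurableType d}.
Variable dist : T -> T -> R.
Hypothesis hmetric : is_metric dist.
Hypothesis hborel : (measurable : set (set T)) = <<s metric_open dist >>.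
Hypothesis hcompact : metric_compact dist.

Definition metric_cont (g : T -> R) : Prop :=
  forall x (e : R), 0 < e ->
    exists2 a : R, 0 < a & forall y, dist x y < a -> `|g x - g y| < e.

Lemma metric_cont_comp (G : R -> R) (g : T -> R) :
  continuous G -> metric_cont g -> metric_cont (G \o g).
Proof.
move=> cG cg x e e0.
have /cvgr_dist_lt/(_ e e0) := cG (g x).
move=> /nbhs_ballP[a /= a0 ha].
have [b b0 hb] := cg x a a0.
by exists b => // y /hb xy; exact: ha.
Qed.

Lemma metric_cont_sqrt_lipschitz (g : T -> R) (C : R) :
  (forall x y, `|g x - g y| <= Num.sqrt (dist x y) * C) -> metric_cont g.
Proof.
move=> gC x e e0.
have C0 : 0 < `|C| + 1 by rewrite ltr_wpDl.
(* [C] may be zero or negative, hence the divisor [|C| + 1]. *)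
exists ((e / (`|C| + 1)) ^+ 2) => [|y xy]; first by rewrite exprn_gt0// divr_gt0.
apply: le_lt_trans (gC x y) _.
have /le_lt_trans : Num.sqrt (dist x y) * C <= Num.sqrt (dist x y) * (`|C| + 1).
  by rewrite ler_wpM2l ?sqrtr_ge0// (le_trans (ler_norm _))// lerDl.
apply; rewrite -ltr_pdivlMr//.
rewrite -ltr_sqr ?nnegrE ?sqrtr_ge0 ?divr_ge0 ?(ltW e0) ?(ltW C0)//.
by rewrite sqr_sqrtr// hmetric.1.
Qed.

Lemma metric_open_measurable U : metric_open dist U -> measurable U.
Proof. by move=> oU; rewrite hborel; exact: sub_sigma_algebra. Qed.

Lemma metric_open_ball x e : metric_open dist [set y | dist x y < e].
Proof.
move=> y /= xy; exists (e - dist x y); rewrite subr_gt0; split=> // z /= yz.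
by rewrite (le_lt_trans (hmetric.2.2.2 x y z))// -ltrBrDl.
Qed.

Lemma metric_open_preimage (g : T -> R) (a b : R) : metric_cont g ->
  metric_open dist [set x | a < g x < b].
Proof.
move=> cg x /= /andP[ax xb].
have m0 : 0 < Num.min (g x - a) (b - g x) by rewrite lt_min !subr_gt0 ax.
have [r r0 hr] := cg x _ m0.
exists r; split => // y /= /hr; rewrite lt_min !ltr_norml => ?.
apply/andP; split; lra.
Qed.

Lemma metric_cont_bmeas (g : T -> R) : metric_cont g -> bmeas g.
Proof.
move=> cg; split.
  move=> mT; apply: (measurability _ (RGenOpens.measurableE R)) => //.
  move=> _ [_ [a [b ->] <-]]; rewrite setTI; apply: metric_open_measurable.
  rewrite (_ : _ @^-1` _ = [set x | a < g x < b]); first exact: metric_open_preimage.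
  by apply/seteqP; split=> x /=; rewrite in_itv.
have [||n [F hF]] := @hcompact nat (fun n : nat => [set x | - n%:R < g x < n%:R]).
- by move=> n; exact: metric_open_preimage.
- move=> x; exists (Num.truncn `|g x|).+1.
  by rewrite /= -ltr_norml truncnS_gt.
(* The sum dominates every [F k] and also makes sense for an empty cover. *)
exists (\sum_k (F k)%:R) => x.
have [k] := hF x; rewrite /= -ltr_norml => /ltW/le_trans; apply.
by rewrite (bigD1 k)//= lerDl sumr_ge0.
Qed.

(** A finite cover by balls is made disjoint by sending each point to the first ball that contains
    it; the [p k] are the indicators of the resulting Borel cells. *)
Lemma fine_partition_of_unity (e : R) : 0 < e ->
  exists n (x : 'I_n -> T) (p : 'I_n -> T -> R),
  [/\ forall k, bmeas (p k), forall k t, 0 <= p k t,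
      forall t, \sum_k p k t = 1 &
      forall k t, p k t != 0 -> dist (x k) t < e].
Proof.
move=> e0.
have [||n [x hx]] := @hcompact T (fun x => [set y | dist x y < e]).
- by move=> x; exact: metric_open_ball.
- by move=> x; exists x; rewrite /= (hmetric.2.1 x x).2.
(* Extended by 0 to all of [nat], so that products over [j < k] can be formed. *)
pose b (k : nat) : T -> R :=
  if insub k is Some i then \1_[set y | dist (x i) y < e] else fun=> 0.
have bE (k : 'I_n) : b k = \1_[set y | dist (x k) y < e] by rewrite /b valK.
have bb k : bmeas (b k).
  rewrite /b; case: insubP => [i _ _|_]; last exact: bmeas_cst.
  exact/bmeas_indic/metric_open_measurable/metric_open_ball.
have b01 k t : 0 <= b k t <= 1.
  rewrite /b; case: insubP => [i _ _|_]; last by rewrite lexx ler01.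
  by rewrite indicE; case: (_ \in _); rewrite ?lexx ler01.
exists n, x, (fun k t => b k t * \prod_(j < k) (1 - b j t)); split.
- move=> k; apply: bmeasM => //; apply: bmeas_prod => j.
  by apply: bmeasB => //; exact: bmeas_cst.
- move=> k t; rewrite mulr_ge0//; first by have /andP[] := b01 k t.
  by apply: prodr_ge0 => j _; rewrite subr_ge0; have /andP[] := b01 j t.
- move=> t; rewrite (sum_first_hit (fun k => b k t)).
  have [k hk] := hx t; rewrite (bigD1 k)//= bE indicE mem_set// subrr mul0r.
  by rewrite subr0.
- move=> k t; rewrite mulf_eq0 negb_or => /andP[+ _].
  by rewrite bE indicE; case: (boolP (t \in _)) => [/set_mem//|]; rewrite eqxx.
Qed.

Section embedding.
Context {V : lmodType R} (ip : V -> V -> R) (f : T -> V).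
Hypothesis hip : is_hilbert_inner_product ip.
Hypothesis hf : forall x y, ipnorm ip (f x - f y) = Num.sqrt (dist x y).
Variables mu1 mu2 : {finite_measure set T -> \bar R}.
Local Notation I := (signed_integral mu1 mu2).
Local Notation m := (total_mass mu1 mu2).

Lemma simkernelE x y : simkernel dist x y = gauss ip (f x) (f y).
Proof.
by rewrite /gauss -(ipnormK hip) hf sqr_sqrtr// hmetric.1.
Qed.

Lemma gauss_embed_lipschitz x y v :
  `|gauss ip (f x) v - gauss ip (f y) v| <= Num.sqrt (dist x y) * 2.
Proof. by rewrite mulrC -hf gauss_lipschitz. Qed.

Lemma bmeas_gauss v : bmeas (fun x => gauss ip (f x) v).
Proof.
apply/metric_cont_bmeas/metric_cont_sqrt_lipschitz => x y.
exact: gauss_embed_lipschitz.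
Qed.

(** Defined at every [v] in [V]; on the image of [f] it is the inner integral of [W_form]. *)
Definition potential (v : V) : R := I (fun x => gauss ip (f x) v).

Lemma potential_lipschitz x y :
  `|potential (f x) - potential (f y)| <= Num.sqrt (dist x y) * (m * 2).
Proof.
rewrite /potential -signed_integralB; try exact: bmeas_gauss.
rewrite mulrCA; apply: signed_integral_bound.
  by apply: bmeasB; exact: bmeas_gauss.
move=> z; rewrite !(gaussC hip (f z)); exact: gauss_embed_lipschitz.
Qed.

Lemma bmeas_potential : bmeas (fun y => potential (f y)).
Proof.
apply/metric_cont_bmeas/metric_cont_sqrt_lipschitz => x y.
exact: potential_lipschitz.
Qed.

Lemma W_formE : W_form dist mu1 mu2 = I (fun y => potential (f y)).
Proof.
rewrite /W_form /potential; congr signed_integral; apply/funext => y.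
by congr signed_integral; apply/funext => x; rewrite simkernelE.
Qed.

Section discretization.
Variables (e : R) (n : nat) (x : 'I_n -> T) (p : 'I_n -> T -> R).
Hypothesis e0 : 0 < e.
Hypothesis bp : forall k, bmeas (p k).
Hypothesis p0 : forall k t, 0 <= p k t.
Hypothesis p1 : forall t, \sum_k p k t = 1.
Hypothesis pe : forall k t, p k t != 0 -> dist (x k) t < e ^+ 2.

(** The mesh is [e ^+ 2] because [f] is isometric for the square root of [dist]: in [V] the cells
    have radius [e]. *)
Lemma sqrt_dist_le k t : p k t != 0 -> Num.sqrt (dist t (x k)) <= e.
Proof.
move=> /pe; rewrite hmetric.2.2.1 => /ltW /(ler_wsqrtr).
by rewrite sqrtr_sqr ger0_norm// ltW.
Qed.

(** The measure is replaced by point masses [I (p k)] at [x k]; moving a point by [e] in [V] changes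
    the Gaussian by at most [2 * e]. *)
Lemma potential_discretization v :
  `|potential v - \sum_k I (p k) * gauss ip (f (x k)) v| <= m * (2 * e).
Proof.
have bpk k : bmeas (fun t => p k t * gauss ip (f (x k)) v).
  by apply: bmeasM => //; exact: bmeas_cst.
have -> : \sum_k I (p k) * gauss ip (f (x k)) v =
    I (fun t => \sum_k p k t * gauss ip (f (x k)) v).
  rewrite signed_integral_sum//; apply: eq_bigr => k _.
  rewrite mulrC -signed_integralZ//; congr signed_integral.
  by apply/funext => t; rewrite mulrC.
rewrite -signed_integralB; [|exact: bmeas_gauss|exact: bmeas_sum].
apply: signed_integral_bound.
  by apply: bmeasB; [exact: bmeas_gauss|exact: bmeas_sum].
move=> t; apply: convex_comb_dist => // k pk.
rewrite (le_trans (gauss_embed_lipschitz _ _ _))// mulrC ler_pM2l//.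
exact: sqrt_dist_le.
Qed.

(** Two errors of [2 * m * e] each, before the outer integration: moving the outer point to [x l],
    then discretizing the potential there. *)
Lemma W_form_discretization :
  `|W_form dist mu1 mu2 -
    \sum_l \sum_k I (p l) * I (p k) * gauss ip (f (x l)) (f (x k))|
  <= m * (4 * m * e).
Proof.
pose b l := \sum_k I (p k) * gauss ip (f (x k)) (f (x l)).
have bpk l : bmeas (fun t => p l t * b l).
  by apply: bmeasM => //; exact: bmeas_cst.
have -> : \sum_l \sum_k I (p l) * I (p k) * gauss ip (f (x l)) (f (x k)) =
    I (fun t => \sum_l p l t * b l).
  rewrite signed_integral_sum//; apply: eq_bigr => l _.
  transitivity (b l * I (p l)).
    rewrite mulr_suml; apply: eq_bigr => k _.
    by rewrite (gaussC hip (f (x l))); ring.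
  rewrite -signed_integralZ//; congr signed_integral.
  by apply/funext => t; rewrite mulrC.
rewrite W_formE -signed_integralB; [|exact: bmeas_potential|exact: bmeas_sum].
apply: signed_integral_bound.
  by apply: bmeasB; [exact: bmeas_potential|exact: bmeas_sum].
move=> t; apply: convex_comb_dist => // l pl.
have -> : 4 * m * e = e * (m * 2) + m * (2 * e) by ring.
rewrite (le_trans (ler_distD (potential (f (x l))) _ _))// lerD//.
  rewrite (le_trans (potential_lipschitz _ _))// ler_wpM2r ?mulr_ge0 ?total_mass_ge0//.
  exact: sqrt_dist_le.
exact: potential_discretization.
Qed.

End discretization.

(* The quadratic form of the measure [mu1 - mu2 + t * dirac v], with [v] an
   arbitrary point of the Hilbert space. *)
Lemma W_form_dirac_ge0 v t :
  0 <= W_form dist mu1 mu2 + 2 * t * potential v + t ^+ 2.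
Proof.
have m0 := total_mass_ge0 mu1 mu2.
(* The first term is the error of [W_form], the second that of [2 * t * potential v], both per unit
   of [e]. *)
apply: (@ge0_of_small _ _ (4 * m * m + 4 * `|t| * m)) => [|e e0].
  by rewrite addr_ge0// !mulr_ge0.
have [n [x [p [bp p0 p1 pe]]]] := @fine_partition_of_unity (e ^+ 2) (exprn_gt0 _ e0).
pose c k := I (p k).
pose Q := \sum_l \sum_k c l * c k * gauss ip (f (x l)) (f (x k)).
pose P := \sum_k c k * gauss ip (f (x k)) v.
have hW : `|W_form dist mu1 mu2 - Q| <= m * (4 * m * e).
  exact: W_form_discretization e0 bp p0 p1 pe.
have hP : `|potential v - P| <= m * (2 * e).
  exact: potential_discretization e0 bp p0 p1 pe v.
(* Index [ord0] carries the extra point [v] with weight [t]; the others carry the sample points. *)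
pose u (i : 'I_n.+1) : V := oapp (fun k => f (x k)) v (unlift ord0 i).
pose a (i : 'I_n.+1) : R := oapp c t (unlift ord0 i).
have := (psd_gauss hip u).2 a.
rewrite big_ord_recl big_ord_recl /u /a !unlift_none/= (gauss_refl hip).
under eq_bigr do rewrite liftK/=.
under [X in _ + X]eq_bigr do rewrite big_ord_recl unlift_none liftK/=.
under [X in _ + X]eq_bigr do under eq_bigr do rewrite liftK/=.
rewrite big_split/=.
rewrite (_ : \sum_(i < n) t * c i * gauss ip v (f (x i)) =
  t * P); last first.
  by rewrite mulr_sumr; apply: eq_bigr => k _; rewrite (gaussC hip v) mulrA.
rewrite (_ : \sum_(i < n) c i * t * gauss ip (f (x i)) v =
  t * P); last first.
  by rewrite mulr_sumr; apply: eq_bigr => k _; ring.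
rewrite -/Q => hQ.
have h1 : t * P <= t * potential v + `|t| * (m * (2 * e)).
  rewrite -lerBlDl -mulrBr (le_trans (ler_norm _))// normrM ler_wpM2l//.
  by rewrite distrC.
have h2 : Q <= W_form dist mu1 mu2 + m * (4 * m * e).
  by rewrite -lerBlDl (le_trans (ler_norm _))// distrC.
lra.
Qed.

Lemma W_form_ge0 : 0 <= W_form dist mu1 mu2.
Proof.
by have := W_form_dirac_ge0 0 0; rewrite mulr0 mul0r expr0n !addr0.
Qed.

(** At [t = - potential v] the nonnegative quantity is minus the square of the potential. *)
Lemma W_form_eq0_potential v : W_form dist mu1 mu2 = 0 -> potential v = 0.
Proof.
move=> W0; have := W_form_dirac_ge0 v (- potential v); rewrite W0 => h.
apply/eqP; rewrite -sqrf_eq0 eq_le sqr_ge0 andbT; nra.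
Qed.

End embedding.
End metric_space.

(** * Functions orthogonal to all exponentials *)

(** A bound uniform in [n], as dominated convergence requires. *)
Lemma series_exp_coeff_bound (R : realType) (x M : R) n : `|x| <= M ->
  `|series (exp_coeff x) n| <= expR M.
Proof.
move=> xM; rewrite (le_trans (ler_norm_sum _ _ _))//.
apply: (@le_trans _ _ (expR `|x|)); last by rewrite ler_expR.
have -> : \sum_(0 <= i < n) `|exp_coeff x i| = series (exp_coeff `|x|) n.
  by rewrite -normed_series_exp_coeff.
apply: nondecreasing_cvgn_le; last exact: is_cvg_series_exp_coeff.
by apply: nondecreasing_series => i _ _; exact: exp_coeff_ge0.
Qed.

(* The weight [n e^(-n a)] with [n] in front makes the limit [0] also at [a = 0],
   so that the limit is the indicator of an open half-line. *)
Lemma cvg_expR_indicator (R : realType) (a : R) :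
  (fun n : nat => expR (- ((n.+1%:R : R) * expR (n.+1%:R * a)))) @ \oo -->
  ((a < 0)%R%:R : R).
Proof.
have h0 := @cvg_harmonic R.
have [a0|a0] := ltP a 0; rewrite ?mulr1n ?mulr0n.
- have c2 : (fun n : nat => 1 - (2 / a ^+ 2) * harmonic n) @ \oo --> (1 : R).
    rewrite -[X in _ --> X]subr0; apply: cvgB; first exact: cvg_cst.
    by rewrite -[X in _ --> X](mulr0 (2 / a ^+ 2)); exact: cvgMl_tmp.
  apply: (squeeze_cvgr _ c2 (cvg_cst (1 : R))); apply: nearW => n; apply/andP; split.
  + apply: le_trans (expR_ge1Dx _); rewrite lerD2l lerN2 /=.
    have N0 : 0 < n.+1%:R :> R by rewrite ltr0n.
    (* With [N = n.+1], [exp y >= y^2 / 2] at [y = - N a] gives [exp (N a) <= 2 / (N a)^2], which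
       beats the factor [N]. *)
    have := @expR_ge1Dxn R (- (n.+1%:R * a)) 1.
    rewrite oppr_ge0 pmulr_rle0// (ltW a0) => /(_ isT).
    rewrite sqrrN (_ : 2`! = 2%N)// expRN => h.
    have e0 := expR_gt0 (n.+1%:R * a).
    have na : n.+1%:R * a < 0 by rewrite pmulr_rlt0.
    have s0 : 0 < (n.+1%:R * a) ^+ 2 / 2.
      by rewrite divr_gt0// exprn_even_gt0//= lt_eqF.
    have : expR (n.+1%:R * a) <= ((n.+1%:R * a) ^+ 2 / 2)^-1.
      rewrite -[leLHS]invrK lef_pV2 ?posrE ?invr_gt0//; lra.
    move=> /(ler_wpM2l (ltW N0))/le_trans; apply.
    rewrite le_eqVlt; apply/orP; left; apply/eqP; field.
    by rewrite nat1r pnatr_eq0 (lt_eqF a0).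
  + by rewrite expR_le1 oppr_le0 mulr_ge0// expR_ge0.
- apply: (squeeze_cvgr _ (cvg_cst (0 : R)) h0); apply: nearW => n; rewrite expR_ge0/=.
  rewrite expRN lef_pV2 ?posrE ?expR_gt0 ?ltr0n//.
  have h1 : 1 <= expR (n.+1%:R * a).
    by rewrite -expR0 ler_expR mulr_ge0.
  have h2 := @expR_ge1Dx R (n.+1%:R * expR (n.+1%:R * a)).
  have : n.+1%:R <= n.+1%:R * expR (n.+1%:R * a) :> R by rewrite ler_peMr.
  lra.
Qed.

Lemma indic_bigsetU_trivIset (R : realType) (T : Type) (F : nat -> set T) n x :
  trivIset setT F ->
  \1_(\big[setU/set0]_(i < n) F i) x = \sum_(i < n) \1_(F i) x :> R.
Proof.
move=> tF; rewrite -bigcup_mkord indicE.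
have [[k /= kn Fk]|nF] := pselect ((\bigcup_(i in `I_n) F i) x).
  rewrite mem_set; last by exists k.
  rewrite (bigD1 (Ordinal kn))//= indicE mem_set//= big1 ?addr0// => i ik.
  rewrite indicE memNset// => Fi; move/eqP: ik; apply; apply/val_inj => /=.
  by apply: tF => //; exists x.
rewrite memNset// big1// => i _; rewrite indicE memNset// => Fi.
by apply: nF; exists i => //=.
Qed.

Section exponential_family.
Context {R : realType} {d} {T : measurableType d}.
Context {V : lmodType R} (ip : V -> V -> R) (f : T -> V).
Hypothesis hip : is_hilbert_inner_product ip.
Variables mu1 mu2 : {finite_measure set T -> \bar R}.
Local Notation I := (signed_integral mu1 mu2).
Let E (w : V) (x : T) : R := expR (ip (f x) w).
Hypothesis bE : forall w, bmeas (E w).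

(** The signed measure [phi (mu1 - mu2)], pushed to [V] by [f], has vanishing Laplace transform. *)
Definition exp_null (phi : T -> R) : Prop :=
  bmeas phi /\ forall w, I (fun x => phi x * expR (ip (f x) w)) = 0.

Lemma exp_nullM phi w : exp_null phi ->
  exp_null (fun x => phi x * expR (ip (f x) w)).
Proof.
move=> [bphi h]; split=> [|v]; first exact: bmeasM bphi (bE w).
rewrite -(h (w + v)); congr signed_integral; apply/funext => x.
by rewrite ipDr// expRD mulrA.
Qed.

Lemma exp_null_sum (J : Type) (r : seq J) (c : J -> R) (phi : J -> T -> R) :
  (forall i, exp_null (phi i)) ->
  exp_null (fun x => \sum_(i <- r) c i * phi i x).
Proof.
move=> h; split=> [|w].
  by apply: bmeas_sum => i; apply: bmeasZ; exact: (h i).1.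
transitivity (I (fun x => \sum_(i <- r) c i * (phi i x * expR (ip (f x) w)))).
  congr signed_integral; apply/funext => x; rewrite mulr_suml.
  by apply: eq_bigr => i _; rewrite mulrA.
have bi i : bmeas (fun x => phi i x * expR (ip (f x) w)).
  exact: bmeasM (h i).1 (bE w).
rewrite signed_integral_sum => [|i]; last exact: bmeasZ.
by apply: big1 => i _; rewrite signed_integralZ// (h i).2 mulr0.
Qed.

Lemma exp_null_lim (phi_ : nat -> T -> R) (phi : T -> R) (M : R) :
  (forall n, exp_null (phi_ n)) -> (forall n x, `|phi_ n x| <= M) ->
  (forall x, phi_ ^~ x @ \oo --> phi x) -> exp_null phi.
Proof.
move=> h hM hphi; split=> [|w].
  split; first by apply: measurable_fun_cvg => [n|x _]; [exact: (h n).1.1|exact: hphi].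
  exists M => x.
  have cn : (fun n => `|phi_ n x|) @ \oo --> `|phi x| by exact: cvg_norm (hphi x).
  rewrite -(cvg_lim _ cn)//; apply: limr_le; first by apply/cvg_ex; eexists; exact: cn.
  exact: nearW.
have [mE [N hN]] := bE w.
apply: (@signed_integral_lim0 _ _ _ _ _ (fun n x => phi_ n x * E w x) _ (M * N)).
- by move=> n; apply: measurable_funM => //; exact: (h n).1.1.
- by move=> n x; rewrite normrM ler_pM.
- by move=> x; apply: cvgMr_tmp.
- by move=> n; exact: (h n).2.
Qed.

(** Powers of [exp <f, w>] are the exponentials of [k w], so the partial sums of the outer series
    stay in the class; they are bounded uniformly because [E w] is. *)
Lemma exp_null_expR phi w s : exp_null phi ->
  exp_null (fun x => phi x * expR (s * expR (ip (f x) w))).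
Proof.
move=> h; have [_ [M hM]] := h.1; have [_ [N hN]] := bE w.
apply: (@exp_null_lim (fun n x => phi x * series (exp_coeff (s * E w x)) n)
    _ (M * expR (`|s| * N))).
- move=> n; have := @exp_null_sum _ (index_iota 0 n)
    (fun k => s ^+ k / k`!%:R) (fun k x => phi x * expR (ip (f x) (k%:R *: w)))
    (fun k => exp_nullM (k%:R *: w) h).
  congr exp_null; apply/funext => x; rewrite /series/= mulr_sumr.
  apply: eq_bigr => k _; rewrite /exp_coeff/= exprMn /E ipZr// expRM_natl; ring.
- move=> n x; rewrite normrM ler_pM// series_exp_coeff_bound// normrM.
  by rewrite ler_wpM2l.
- by move=> x; apply: cvgMl_tmp; exact: cvg_series_expR.
Qed.

Lemma exp_null_half_space phi w c : exp_null phi ->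
  exp_null (fun x => phi x * (ip (f x) w < c)%R%:R).
Proof.
move=> h; have [_ [M hM]] := h.1.
apply: (@exp_null_lim (fun n x => phi x *
    expR (- (n.+1%:R * expR (n.+1%:R * (ip (f x) w - c))))) _ M).
(* The threshold [c] is absorbed into the scalar in front of the inner exponential. *)
- move=> n; have := exp_null_expR (n.+1%:R *: w) (- (n.+1%:R * expR (- (n.+1%:R * c)))) h.
  congr exp_null; apply/funext => x; congr (_ * expR _).
  by rewrite ipZr// mulNr -mulrA -expRD; congr (- (_ * expR _)); ring.
- move=> n x; rewrite normrM -[leRHS]mulr1 ler_pM// ger0_norm ?expR_ge0//.
- by move=> x; apply: cvgMl_tmp; rewrite -subr_lt0; exact: cvg_expR_indicator.
Qed.

(** With lists, intersection is concatenation and the empty list is the whole space, so these sets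
    form a pi-system. *)
Definition half_spaces (s : seq (V * R)) : set T :=
  [set x | all (fun p => ip (f x) p.1 < p.2) s].

Lemma exp_null_half_spaces phi s : exp_null phi ->
  exp_null (fun x => phi x * \1_(half_spaces s) x).
Proof.
elim: s phi => [|[w c] s IH] phi h.
  move: h; congr exp_null; apply/funext => x.
  by rewrite indicE mem_set// mulr1.
have := IH _ (exp_null_half_space w c h); congr exp_null; apply/funext => x.
rewrite -mulrA; congr (_ * _); rewrite !indicE -natrM mulnb; congr (nat_of_bool _)%:R.
apply/idP/idP => [/andP[wc /set_mem hs]|/set_mem/= /andP[-> hs]].
  by apply/mem_set; rewrite /half_spaces/= wc.
by apply/mem_set.
Qed.

Lemma half_spaces_setI_closed : setI_closed (range half_spaces).
Proof.
move=> _ _ [s _ <-] [s' _ <-]; exists (s ++ s') => //.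
apply/seteqP; split=> x; rewrite /half_spaces/= all_cat.
  by move=> /andP[].
by move=> [-> ->].
Qed.

(** Dynkin's theorem: the sets with vanishing integral contain the whole space and are stable under
    complements and countable disjoint unions. *)
Lemma signed_integral_eq0_generated phi : bmeas phi ->
  (measurable : set (set T)) = <<s range half_spaces >> ->
  (forall s, I (fun x => phi x * \1_(half_spaces s) x) = 0) ->
  forall A, measurable A -> I (fun x => phi x * \1_A x) = 0.
Proof.
move=> bphi gen h0 A; rewrite gen.
have hT : I phi = 0.
  rewrite -(h0 [::]); congr signed_integral; apply/funext => x.
  by rewrite indicE mem_set// mulr1.
have bphiA (B : set T) : measurable B -> bmeas (fun x => phi x * \1_B x).
  by move=> mB; apply: bmeasM => //; exact: bmeas_indic.
apply: (dynkin_induction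
  (P := fun B => I (fun x => phi x * \1_B x) = 0) gen half_spaces_setI_closed).
- by rewrite -[RHS]hT; congr signed_integral; apply/funext => x; rewrite indicT mulr1.
- by move=> _ [s _ <-].
- move=> B mB hB; have := signed_integralB mu1 mu2 bphi (bphiA _ mB).
  rewrite hT hB subr0 => <-; congr signed_integral; apply/funext => x.
  by rewrite indicC/= indicE; case: (x \in B); rewrite ?mulr1 ?mulr0 ?subrr ?subr0.
- move=> F mF tF hF; have [_ [M hM]] := bphi.
  have mU n : measurable (\big[setU/set0]_(i < n) F i).
    by apply: bigsetU_measurable => i _.
  apply: (@signed_integral_lim0 _ _ _ _ _
    (fun n x => phi x * \1_(\big[setU/set0]_(i < n) F i) x) _ M).
  + by move=> n; exact: (bphiA _ (mU n)).1.
  + move=> n x; rewrite normrM -[leRHS]mulr1 ler_pM// indicE.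
    by case: (_ \in _); rewrite ?normr1 ?normr0.
  (* At each point the indicators of the partial unions are eventually constant. *)
  + move=> x; apply: cvgMl_tmp; apply: cvg_near_cst.
    have [[k _ Fk]|nF] := pselect ((\bigcup_k F k) x).
      near=> n; rewrite !indicE !mem_set//; first by exists k.
      by rewrite -bigcup_mkord; exists k => //=; near: n; exact: nbhs_infty_gt.
    apply: nearW => n; rewrite !indicE !memNset// -bigcup_mkord.
    by move=> [k _ Fk]; apply: nF; exists k.
  + move=> n; have := signed_integral_sum mu1 mu2 (index_enum 'I_n)
      (fun i : 'I_n => bphiA _ (mF i)).
    rewrite [X in _ = X -> _]big1 => [<-|i _]; last exact: hF.
    congr signed_integral; apply/funext => x.
    by rewrite -mulr_sumr indic_bigsetU_trivIset.
Unshelve. all: by end_near. Qed.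

End exponential_family.

(** * Half-spaces generate the Borel sets *)

Section borel_half_spaces.
Context {R : realType} {d} {T : measurableType d}.
Variable dist : T -> T -> R.
Hypothesis hmetric : is_metric dist.
Hypothesis hborel : (measurable : set (set T)) = <<s metric_open dist >>.
Hypothesis hcompact : metric_compact dist.
Context {V : lmodType R} (ip : V -> V -> R) (f : T -> V).
Hypothesis hip : is_hilbert_inner_product ip.
Hypothesis hf : forall x y, ipnorm ip (f x - f y) = Num.sqrt (dist x y).

Lemma metric_openI A B : metric_open dist A -> metric_open dist B ->
  metric_open dist (A `&` B).
Proof.
move=> oA oB x [/oA[a [a0 aA]] /oB[b [b0 bB]]].
exists (Num.min a b); split; first by rewrite lt_min a0.
by move=> y /=; rewrite lt_min => /andP[xa xb]; split; [exact: aA|exact: bB].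
Qed.

Lemma metric_open_lt (g : T -> R) c : metric_cont dist g ->
  metric_open dist [set x | g x < c].
Proof.
move=> cg x /= xc; have [|r r0 hr] := cg x (c - g x); first by rewrite subr_gt0.
by exists r; split=> // y /= /hr; rewrite ltr_norml => /andP[? ?]; lra.
Qed.

Lemma metric_cont_ip w : metric_cont dist (fun x => ip (f x) w).
Proof.
apply: (@metric_cont_sqrt_lipschitz _ _ _ _ hmetric _ (ipnorm ip w)) => x y.
by rewrite -ipBl// -hf cauchy_schwarz.
Qed.

Lemma metric_open_half_spaces s : metric_open dist (half_spaces ip f s).
Proof.
elim: s => [|[w c] s IH]; first by move=> x _; exists 1.
rewrite (_ : half_spaces _ _ _ =
  [set x | ip (f x) w < c] `&` half_spaces ip f s).
  by apply: metric_openI => //; exact/metric_open_lt/metric_cont_ip.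
by apply/seteqP; split=> x; rewrite /half_spaces /= => /andP.
Qed.

(** Each [y] other than [x] is separated from [x] by the hyperplane bisecting [f x] and [f y]. The
    half-spaces on the side of [y], together with [U], cover [T]; for a finite subcover, the
    opposite half-spaces intersect inside [U]. *)
Lemma half_spaces_basis (U : set T) x : metric_open dist U -> U x ->
  exists s, half_spaces ip f s x /\ half_spaces ip f s `<=` U.
Proof.
move=> oU Ux.
pose w y := f y - f x.
pose c y := (ip (f x) (w y) + ip (f y) (w y)) / 2.
have wc y : y <> x -> ip (f x) (w y) < c y < ip (f y) (w y).
  move=> yx; have : 0 < ip (w y) (w y).
    rewrite -(ipnormK hip) hf sqr_sqrtr ?hmetric.1//.
    rewrite lt_neqAle hmetric.1 andbT eq_sym; apply/eqP => /(hmetric.2.1 _ _).1.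
    exact: yx.
  rewrite {1}/w ipBl// /c => ?; apply/andP; split; lra.
pose W (o : option {y | y <> x}) : set T :=
  if o is Some y then [set z | ip (f z) (- w (sval y)) < - c (sval y)] else U.
(* [None], which stands for [U], gets the trivial condition [0 < 1]. *)
pose h (o : option {y | y <> x}) : V * R :=
  if o is Some y then (w (sval y), c (sval y)) else (0, 1).
have [||n [g hg]] := @hcompact _ W.
- by case=> // y; exact/metric_open_lt/metric_cont_ip.
- move=> z; have [zx|zx] := pselect (z = x); first by exists None; rewrite zx.
  exists (Some (exist _ z zx)); rewrite /= ipNr// ltrN2.
  by have /andP[] := wc _ zx.
exists [seq h (g k) | k <- enum 'I_n]; split.
  rewrite /half_spaces /= all_map; apply/allP => k _ /=.
  case: (g k) => [[y yx]|] /=; first by have /andP[] := wc _ yx.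
  by rewrite ip0r.
move=> z; rewrite /half_spaces /= all_map => /allP hz.
have [k] := hg z; have := hz k; rewrite mem_enum => /(_ isT) /=.
case: (g k) => [[y yx]|] //=; rewrite ipNr// ltrN2 => h1 h2.
by have := lt_trans h1 h2; rewrite ltxx.
Qed.

(* By compactness each [{x | ball x (1/n) `<=` U}] is covered by finitely many
   basic sets inside [U]; the union over [n] is [U]. *)
Lemma metric_open_half_spaces_generated (U : set T) : metric_open dist U ->
  <<s range (half_spaces ip f) >> U.
Proof.
move=> oU.
pose G : set (set (g_sigma_algebraType (range (half_spaces ip f)))) := measurable.
have [s hs] : {s : T -> seq (V * R) & forall x, U x ->
    half_spaces ip f (s x) x /\ half_spaces ip f (s x) `<=` U}.
  apply: (@choice _ _ (fun x s => U x ->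
    half_spaces ip f s x /\ half_spaces ip f s `<=` U)) => x.
  have [Ux|nUx] := pselect (U x); last by exists [::].
  by have [s ?] := half_spaces_basis oU Ux; exists s.
have step n : exists B, [/\ G B, B `<=` U &
    forall x, [set y | dist x y < n.+1%:R^-1] `<=` U -> B x].
  pose W x := if `[< U x >] then half_spaces ip f (s x)
    else [set y | dist x y < n.+1%:R^-1].
  have [||N [g hg]] := @hcompact _ W.
  - move=> x; rewrite /W; case: ifP => _; first exact: metric_open_half_spaces.
    exact: metric_open_ball.
  - move=> x; exists x; rewrite /W; case: ifPn => [/asboolP/hs[]//|_].
    by rewrite /= (hmetric.2.1 x x).2.
  pose F k := if `[< U (g k) >] then half_spaces ip f (s (g k)) else set0.
  exists (\bigcup_k F k); split.
  - apply: (@fin_bigcup_measurable _ (g_sigma_algebraType _)) => // k _.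
    rewrite /F; case: ifP => _.
      by apply: sub_sigma_algebra; exists (s (g k)).
    exact: measurable0.
  - move=> y [k _]; rewrite /F.
    by case: ifP => // /asboolP/hs[_]; exact.
  - move=> x xU; have [k] := hg x; rewrite /W.
    case: ifPn => [gk hk|/asboolP ngk /= gx].
      by exists k => //; rewrite /F gk.
    (* A small ball centred outside [U] cannot contain [x]: its centre would lie in the ball around
       [x], hence in [U]. *)
    by exfalso; apply/ngk/xU; rewrite /= hmetric.2.2.1.
have [B hB] := choice step.
rewrite (_ : U = \bigcup_n B n).
  by apply: (@bigcup_measurable _ (g_sigma_algebraType _)) => n _; have [] := hB n.
apply/seteqP; split=> [x Ux|x [n _]]; last by have [_ + _] := hB n; apply.
have [e [e0 eU]] := oU x Ux.
exists (Num.truncn e^-1) => //; have [_ _] := hB (Num.truncn e^-1); apply.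
move=> y /= xy; apply: eU => /=; apply: lt_trans xy _.
by rewrite invf_plt ?posrE ?ltr0n// truncnS_gt.
Qed.

Lemma borel_half_spaces :
  (measurable : set (set T)) = <<s range (half_spaces ip f) >>.
Proof.
apply/seteqP; split.
  rewrite hborel; apply: smallest_sub; first exact: smallest_sigma_algebra.
  exact: metric_open_half_spaces_generated.
apply: smallest_sub; first exact: sigma_algebra_measurable.
move=> _ [s _ <-]; apply: (metric_open_measurable hborel).
exact: metric_open_half_spaces.
Qed.

(** * From a vanishing potential to a vanishing measure *)

Variables mu1 mu2 : {finite_measure set T -> \bar R}.
Local Notation I := (signed_integral mu1 mu2).

Lemma bmeas_expR_ip w : bmeas (fun x => expR (ip (f x) w)).
Proof.
apply: (metric_cont_bmeas hborel hcompact).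
exact: metric_cont_comp (@continuous_expR R) (metric_cont_ip w).
Qed.

Lemma bmeas_expR_sqnorm : bmeas (fun x => expR (ip (f x) (f x))).
Proof.
apply: (metric_cont_bmeas hborel hcompact).
have -> : (fun x => expR (ip (f x) (f x))) =
    (fun t : R => expR (t ^+ 2)) \o (fun x => ipnorm ip (f x)).
  by apply/funext => x; rewrite /= ipnormK.
apply: metric_cont_comp.
  move=> t; apply: (@continuous_comp _ _ _ (fun t : R => t ^+ 2) expR).
    exact: exprn_continuous.
  exact: continuous_expR.
apply: (@metric_cont_sqrt_lipschitz _ _ _ _ hmetric _ 1) => x y.
by rewrite mulr1 -hf ipnorm_dist.
Qed.

Lemma potential0_exp_null : (forall v, potential ip f mu1 mu2 v = 0) ->
  exp_null ip f mu1 mu2 (fun x => expR (- ip (f x) (f x))).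
Proof.
move=> h0; split=> [|w].
  have := bmeas_gauss hmetric hborel hcompact hip hf 0.
  by congr bmeas; apply/funext => x; rewrite /gauss subr0.
(* [gaussE] produces the exponent [<f x, 2 v>], which is [<f x, w>] for this [v]; the remaining
   factor is a nonzero constant. *)
pose v := 2^-1 *: w.
have := h0 v; rewrite /potential.
have bi : bmeas (fun x => expR (- ip (f x) (f x)) * expR (ip (f x) w)).
  apply: bmeasM (bmeas_expR_ip w).
  have := bmeas_gauss hmetric hborel hcompact hip hf 0.
  by congr bmeas; apply/funext => x; rewrite /gauss subr0.
rewrite (_ : (fun x => _) = (fun x => expR (- ip v v) *
    (expR (- ip (f x) (f x)) * expR (ip (f x) w)))).
  by rewrite signed_integralZ// => /eqP; rewrite mulf_eq0 expR_eq0 => /eqP.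
apply/funext => x; rewrite (gaussE hip) /v scalerA divff// scale1r; ring.
Qed.

(** The weight [phi] is divided out by writing [\1_A = phi * g] with [g] bounded and nonnegative,
    and approximating [g] from below by simple functions. *)
Lemma potential0_signed_integral0 : (forall v, potential ip f mu1 mu2 v = 0) ->
  forall A, measurable A -> I (\1_A) = 0.
Proof.
move=> h0 A mA; pose phi x := expR (- ip (f x) (f x)).
have hphi : exp_null ip f mu1 mu2 phi := potential0_exp_null h0.
have phi0 B : measurable B -> I (fun x => phi x * \1_B x) = 0.
  apply: (signed_integral_eq0_generated (ip := ip) (f := f)) hphi.1 borel_half_spaces _ B.
  move=> s; have [_ h] := exp_null_half_spaces hip bmeas_expR_ip s hphi.
  (* Taking [w = 0] removes the exponential. *)
  have := h 0; congr (_ = _); congr signed_integral; apply/funext => x.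
  by rewrite ip0r// expR0 mulr1.
pose g x := \1_A x * expR (ip (f x) (f x)).
have [mg [M gM]] : bmeas g.
  by apply: bmeasM; [exact: bmeas_indic|exact: bmeas_expR_sqnorm].
have g0 x : 0 <= g x by rewrite mulr_ge0 ?expR_ge0.
have mEg : measurable_fun setT (EFin \o g) by exact/measurable_EFinP.
pose g_ := nnsfun_approx measurableT mEg.
have g_cvg x : (fun n => g_ n x) @ \oo --> g x.
  apply: (@fine_cvg _ _ _ _ (EFin \o g_ ^~ x)).
  by apply: cvg_nnsfun_approx => // y _; rewrite lee_fin; exact: g0.
have g_le n x : g_ n x <= g x.
  rewrite -(cvg_lim _ (g_cvg x))//; apply: nondecreasing_cvgn_le.
    by move=> i j ij; exact/lefP/nd_nnsfun_approx.
  by apply/cvg_ex; exists (g x); exact: g_cvg.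
have [_ [N phiN]] := hphi.1.
rewrite (_ : \1_A = (fun x => phi x * g x)); last first.
  apply/funext => x; rewrite /phi /g mulrCA -expRD addNr expR0 mulr1 //.
apply: (@signed_integral_lim0 _ _ _ _ _ (fun n x => phi x * g_ n x) _ (N * M)).
- move=> n; apply: measurable_funM; first exact: hphi.1.1.
  exact: measurable_funPT.
- move=> n x; rewrite normrM ler_pM// (le_trans _ (gM x))//.
  by rewrite !ger0_norm.
- by move=> x; exact: cvgMl_tmp.
- move=> n; pose c (i : nat) : R := (finmap.enum_fset (fset_set (range (g_ n))))`_i.
  have mc i : measurable (g_ n @^-1` [set c i]) by exact: measurable_funPTI.
  transitivity (I (fun x => \sum_(i < size (finmap.enum_fset (fset_set (range (g_ n)))))
      c i * (phi x * \1_(g_ n @^-1` [set c i]) x))).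
    congr signed_integral; apply/funext => x; rewrite fimfunEord mulr_sumr.
    by apply: eq_bigr => i _; rewrite mulrCA.
  have bi i : bmeas (fun x => phi x * \1_(g_ n @^-1` [set c i]) x).
    by apply: bmeasM; [exact: hphi.1|exact: bmeas_indic].
  rewrite signed_integral_sum => [|i]; last exact: bmeasZ.
  by apply: big1 => i _; rewrite signed_integralZ// phi0// mulr0.
Qed.

End borel_half_spaces.

Unset Implicit Arguments.

Theorem theorem2p2 (R : realType) (d : measure_display) (T : measurableType d)
  (dist : T -> T -> R)
  (hmetric : is_metric dist)
  (hborel : (measurable : set (set T)) = <<s metric_open dist >>)
  (hcompact : metric_compact dist)
  (hneg : negative_type dist)
  (nu : {charge set T -> \bar R})
  (mu1 mu2 : {finite_measure set T -> \bar R})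
  (hdec : forall A, measurable A -> nu A = (mu1 A - mu2 A)%E) :
  0 <= W_form dist mu1 mu2 /\
  (W_form dist mu1 mu2 = 0 -> forall A, measurable A -> nu A = 0%E).
Proof.
have [V [ip [f [hip hf]]]] := hneg.
split; first exact: (W_form_ge0 hmetric hborel hcompact hip hf).
move=> W0 A mA.
have h0 v : potential ip f mu1 mu2 v = 0.
  exact: (W_form_eq0_potential hmetric hborel hcompact hip hf).
have := potential0_signed_integral0 hmetric hborel hcompact hip hf h0 mA.
rewrite signed_integral_indic// => h; rewrite hdec//.
by rewrite -[mu1 A]fineK ?fin_num_measure// -[mu2 A]fineK ?fin_num_measure// -EFinB h.
Qed.
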